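(* Let $\mathcal{X}\in\mathbb{R}^{I_1\times\cdots\times I_N}$ be an $N$-order real tensor. Then for every non-identity permutation $\sigma\in S_N$, $\operatorname{rank}(\mathcal{X}^{T\sigma})=\operatorname{rank}(\mathcal{X})$.
   Context: Tensor transpose: for a non-identity permutation $\sigma\in S_N$ and an $N$-order tensor $\mathcal{X}$ of size $I_1\times\cdots\times I_N$, the transpose $\mathcal{X}^{T\sigma}$ is the tensor of size $I_{\sigma(1)}\times\cdots\times I_{\sigma(N)}$ with entries $\mathcal{X}^{T\sigma}(i_{\sigma(1)},\dots,i_{\sigma(N)})=\mathcal{X}(i_1,\dots,i_N)$ for all indices. A rank-one $N$-order tensor is an outer product $u_1\circ\cdots\circ u_N$ of $N$ real vectors, i.e. the tensor with entries $u_1(i_1)u_2(i_2)\cdots u_N(i_N)$. The rank of a tensor is the smallest number of rank-one tensors that sum exactly to that tensor (the zero tensor, as an empty sum, has rank $0$). *)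

(* Defs.v *)
From mathcomp Require Import all_boot all_order all_algebra all_fingroup.
From mathcomp Require Import boolp classical_sets reals.

Set Implicit Arguments.
Unset Strict Implicit.
Unset Printing Implicit Defensive.

Import Order.TTheory GRing.Theory Num.Theory.
Local Open Scope ring_scope.

Definition multi_index (N : nat) (I : 'I_N -> nat) :=
  {dffun forall k : 'I_N, 'I_(I k)}.

Definition tensor (R : realType) (N : nat) (I : 'I_N -> nat) :=
  {ffun multi_index I -> R}.

Definition transpose_size (N : nat) (s : 'S_N) (I : 'I_N -> nat) : 'I_N -> nat :=
  fun k => I (s k).

Definition permute_index (N : nat) (I : 'I_N -> nat) (s : 'S_N)
    (i : multi_index I) : multi_index (transpose_size s I) :=
  [ffun k : 'I_N => i (s k) : 'I_(transpose_size s I k)].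

(* The inverse of [permute_index s]; the cast is needed because the entry
   [j (s^-1 l)] lives in ['I_(I (s (s^-1 l)))]. *)
Definition unpermute_index (N : nat) (I : 'I_N -> nat) (s : 'S_N)
    (j : multi_index (transpose_size s I)) : multi_index I :=
  [ffun l : 'I_N => cast_ord (congr1 I (permKV s l)) (j ((s^-1)%g l))].

Definition transpose (R : realType) (N : nat) (I : 'I_N -> nat) (s : 'S_N)
    (X : tensor R I) : tensor R (transpose_size s I) :=
  [ffun j : multi_index (transpose_size s I) => X (unpermute_index j)].

Lemma permute_indexK (N : nat) (I : 'I_N -> nat) (s : 'S_N) :
  cancel (@permute_index N I s) (@unpermute_index N I s).
Proof.
move=> i; apply/ffunP => l; apply: val_inj; rewrite !ffunE /=.
by rewrite permKV.
Qed.

Lemma unpermute_indexK (N : nat) (I : 'I_N -> nat) (s : 'S_N) :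
  cancel (@unpermute_index N I s) (@permute_index N I s).
Proof.
move=> j; apply/ffunP => k; apply: val_inj; rewrite !ffunE /=.
by rewrite permK.
Qed.

(* The equation characterizing the transpose: its entry at
   (i_(s 0), ..., i_(s (N-1))) is the entry of X at (i_0, ..., i_(N-1)). *)
Lemma transposeE (R : realType) (N : nat) (I : 'I_N -> nat) (s : 'S_N)
    (X : tensor R I) (i : multi_index I) :
  transpose s X (permute_index s i) = X i.
Proof. by rewrite ffunE permute_indexK. Qed.

Definition outer (R : realType) (N : nat) (I : 'I_N -> nat)
    (u : forall k : 'I_N, 'rV[R]_(I k)) : tensor R I :=
  [ffun i : multi_index I => \prod_(k < N) u k 0 (i k)].

Definition rank_one (R : realType) (N : nat) (I : 'I_N -> nat)
    (Y : tensor R I) : Prop :=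
  exists u : forall k : 'I_N, 'rV[R]_(I k), Y = outer u.

Definition rank_one_sum (R : realType) (N : nat) (I : 'I_N -> nat)
    (X : tensor R I) (r : nat) : Prop :=
  exists2 Y : 'I_r -> tensor R I,
    (forall t, rank_one (Y t)) & X = \sum_(t < r) Y t.

Definition is_tensor_rank (R : realType) (N : nat) (I : 'I_N -> nat)
    (X : tensor R I) (r : nat) : Prop :=
  rank_one_sum X r /\ (forall q : nat, rank_one_sum X q -> (r <= q)%N).

(* The default value 0 is only reachable for N = 0, see [tensor_rankP]. *)
Definition tensor_rank (R : realType) (N : nat) (I : 'I_N -> nat)
    (X : tensor R I) : nat :=
  xget 0%N [set r | is_tensor_rank X r]%classic.

Lemma rank_one_sum_ex (R : realType) (N : nat) (I : 'I_N -> nat)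
    (X : tensor R I) :
  (0 < N)%N -> exists r, rank_one_sum X r.
Proof.
move=> N_gt0; pose k0 : 'I_N := Ordinal N_gt0.
pose u (e : multi_index I) (k : 'I_N) : 'rV[R]_(I k) :=
  \row_j ((if k == k0 then X e else 1) * (j == e k)%:R).
exists #|{: multi_index I}|.
exists (fun t => outer (u (enum_val t))); first by move=> t; eexists.
rewrite -(big_enum_val (fun e => outer (u e))) /=.
apply/ffunP => i; rewrite sum_ffunE (bigD1 i) //= big1 ?addr0.
  rewrite ffunE (bigD1 k0) //= big1 ?mulr1; last first.
    by move=> k /negPf nk; rewrite mxE nk eqxx mulr1.
  by rewrite mxE !eqxx mulr1.
move=> e ne; rewrite ffunE.
have [k nk] : exists k, i k != e k.
  apply/existsP; apply: contraR ne => /existsPn h; apply/eqP/ffunP => k.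
  by apply/esym/eqP; have := h k; rewrite negbK.
by rewrite (bigD1 k) //= mxE (negPf nk) mulr0 mul0r.
Qed.

Lemma tensor_rankP (R : realType) (N : nat) (I : 'I_N -> nat)
    (X : tensor R I) :
  (0 < N)%N -> is_tensor_rank X (tensor_rank X).
Proof.
move=> /(rank_one_sum_ex X) [r Xr].
have ex : exists q, `[< rank_one_sum X q >] by exists r; apply/asboolP.
suff exr : exists q, is_tensor_rank X q by apply: (xgetPex 0%N exr).
case: (ex_minnP ex) => m /asboolP Xm m_min; exists m; split=> // q Xq.
by apply: m_min; apply/asboolP.
Qed.

(* Main.v *)
(* Transposition permutes the factors of an outer product, so it is an additive
   bijection preserving rank-one tensors in both directions; hence a tensor and
   its transpose have decompositions of exactly the same lengths. *)
Require Import Defs.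
From mathcomp Require Import all_boot all_order all_algebra all_fingroup.
From mathcomp Require Import reals.
From mathcomp Require Import boolp.

Set Implicit Arguments.
Unset Strict Implicit.
Unset Printing Implicit Defensive.

Import GRing.Theory.
Local Open Scope ring_scope.

Lemma transpose_outer (R : realType) (N : nat) (I : 'I_N -> nat) (s : 'S_N)
    (u : forall k : 'I_N, 'rV[R]_(I k)) :
  transpose s (outer u) =
  outer (fun k => u (s k) : 'rV[R]_(transpose_size s I k)).
Proof.
(* Every index of the transpose has the form [permute_index s i], so [transposeE] applies; the two
   products then differ only by reindexing along [s]. *)
apply/ffunP => j; rewrite -(unpermute_indexK j) transposeE !ffunE.
rewrite (reindex_perm s) /=; apply: eq_bigr => k _.
by rewrite [permute_index _ _ k]ffunE.
Qed.

(** Relabels the factors of a rank-one transpose as factors for the original sizes. Prescribing [u]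
    at [s k] rather than at [l] keeps casts out of the statement. *)
Lemma perm_family_ex (R : realType) (N : nat) (I : 'I_N -> nat) (s : 'S_N)
    (v : forall k : 'I_N, 'rV[R]_(transpose_size s I k)) :
  exists u : forall l : 'I_N, 'rV[R]_(I l), forall k, u (s k) = v k.
Proof.
exists (fun l => castmx (erefl 1, congr1 I (permKV s l)) (v ((s^-1)%g l))).
(* Generalizing the cast proof and then [(s^-1)%g (s k)] allows elimination of the equation with
   [k], after which the cast is between equal sizes. *)
move=> k; move: (congr1 I _) => e.
have : (s^-1)%g (s k) = k by rewrite permK.
move: ((s^-1)%g (s k)) e => k' e k'k; case: k / k'k e => e.
by rewrite castmx_id.
Qed.

Lemma transpose_inj (R : realType) (N : nat) (I : 'I_N -> nat) (s : 'S_N) :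
  injective (@transpose R N I s).
Proof.
by move=> X Y XY; apply/ffunP => i; rewrite -(transposeE s) XY transposeE.
Qed.

Lemma transpose_surj (R : realType) (N : nat) (I : 'I_N -> nat) (s : 'S_N)
    (Z : tensor R (transpose_size s I)) :
  exists X : tensor R I, transpose s X = Z.
Proof.
exists [ffun i => Z (permute_index s i)].
by apply/ffunP => j; rewrite !ffunE unpermute_indexK.
Qed.

Lemma transpose_sum (R : realType) (N : nat) (I : 'I_N -> nat) (s : 'S_N)
    (r : nat) (Y : 'I_r -> tensor R I) :
  transpose s (\sum_(t < r) Y t) = \sum_(t < r) transpose s (Y t).
Proof.
apply/ffunP => j; rewrite ffunE !sum_ffunE.
by apply: eq_bigr => t _; rewrite ffunE.
Qed.

Lemma rank_one_transpose (R : realType) (N : nat) (I : 'I_N -> nat)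
    (s : 'S_N) (Y : tensor R I) :
  rank_one (transpose s Y) <-> rank_one Y.
Proof.
split=> [[v Yv]|[u ->]]; last by eexists; exact: transpose_outer.
have [u uv] := perm_family_ex v; exists u.
apply: (@transpose_inj _ _ _ s); rewrite Yv transpose_outer.
by congr outer; apply: functional_extensionality_dep => k; rewrite uv.
Qed.

Lemma rank_one_sum_transpose (R : realType) (N : nat) (I : 'I_N -> nat)
    (s : 'S_N) (X : tensor R I) (r : nat) :
  rank_one_sum (transpose s X) r <-> rank_one_sum X r.
Proof.
split=> [[Z Z1 XZ]|[Y Y1 ->]]; last first.
  exists (fun t => transpose s (Y t)); last exact: transpose_sum.
  by move=> t; apply/rank_one_transpose.
(* Choice picks preimages of all the summands at once; injectivity then carries the decomposition
   back to [X]. *)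
have [Y YZ] := choice (fun t => transpose_surj (Z t)); exists Y.
  by move=> t; apply/(rank_one_transpose s); rewrite YZ.
apply: (@transpose_inj _ _ _ s); rewrite XZ transpose_sum.
by apply: eq_bigr => t _; rewrite YZ.
Qed.

Theorem proposition5p3 (R : realType) (N : nat) (I : 'I_N -> nat)
    (X : tensor R I) (s : 'S_N) :
  s <> 1%g -> tensor_rank (transpose s X) = tensor_rank X.
Proof.
move=> _; rewrite /tensor_rank /is_tensor_rank.
(* The rank depends on the tensor only through the predicate [rank_one_sum], so equal predicates
   give the same [xget] value, with no minimal length to exhibit. *)
suff -> : rank_one_sum (transpose s X) = rank_one_sum X by [].
by apply/funext => r; apply/propext/rank_one_sum_transpose.
Qed.
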